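(* Let $G$ be a finite simple undirected connected graph with $\operatorname{diam}(G)\geqslant 3$. Then $D_2(G)$ is connected if and only if $D_2(\hat{G})$ is connected.
   Context: All graphs are finite, simple and undirected. $d(x,y)$ is the length of a shortest path between $x$ and $y$, and $\operatorname{diam}(G)$ is the maximum distance between vertices of $G$. For any graph $F$, the $2$-distance graph $D_2(F)$ has vertex set $V(F)$, and two vertices are adjacent in $D_2(F)$ if and only if their distance in $F$ is exactly $2$. For $x\in V(G)$, $N(x)$ is the set of vertices adjacent to $x$, and for $A\subseteq V(G)$, $N(A)=\bigcup_{a\in A}N(a)$. A non-empty set $A\subseteq V(G)$ is called Fine if $N(A)\setminus A\neq\emptyset$ and $N(x)\setminus A=N(A)\setminus A$ for every $x\in A$. A maximal Fine set is a Fine set that is maximal with respect to inclusion among Fine sets. If $G$ is connected with $\operatorname{diam}(G)\geqslant 3$, every vertex $x$ lies in a unique maximal Fine set, denoted $\hat{x}$, so the maximal Fine sets partition $V(G)$. The graph $\hat{G}$ has vertex set $\{\hat{x}: x\in V(G)\}$ (the set of maximal Fine sets of $G$), and two distinct vertices $\hat{x},\hat{y}$ are adjacent in $\hat{G}$ if and only if $x$ and $y$ are adjacent in $G$ (this does not depend on the choice of representatives). *)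

(* Defs.v *)
From mathcomp Require Import all_boot.

Set Implicit Arguments.
Unset Strict Implicit.
Unset Printing Implicit Defensive.

(* A finite simple graph is a symmetric, irreflexive e : rel T on T : finType. *)

Section Graph.
Variables (T : finType) (e : rel T).

Definition connected : Prop := forall x y : T, connect e x y.

Definition has_path (d : nat) (x y : T) : bool :=
  [exists p : d.-tuple T, [&& path e x p, last x p == y & uniq (x :: p)]].

(* None encodes infinite distance: a path on distinct vertices has length
   < #|T|, so the range iota 0 #|T| contains all possible lengths. *)
Definition dist (x y : T) : option nat :=
  ohead [seq d <- iota 0 #|T| | has_path d x y].

(* Meaningful for connected graphs only: pairs at infinite distance are
   counted as 0. *)
Definition diam : nat := \max_(x : T) \max_(y : T) odflt 0 (dist x y).

Definition D2 : rel T := fun x y => dist x y == Some 2.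

Definition nbhd (x : T) : {set T} := [set y | e x y].

Definition nbhds (A : {set T}) : {set T} := \bigcup_(a in A) nbhd a.

Definition Fine (A : {set T}) : bool :=
  [&& A != set0, nbhds A :\: A != set0
    & [forall x in A, nbhd x :\: A == nbhds A :\: A]].

Definition hat_vertex : finType := {A : {set T} | maxset Fine A}.

(* For connected graphs of diameter >= 3 the maximal Fine sets partition the
   vertices and adjacency does not depend on the representatives x and y, so
   the existential below agrees with any choice of representatives. *)
Definition hat_adj : rel hat_vertex :=
  fun A B => (A != B) && [exists x in val A, exists y in val B, e x y].

End Graph.

(* Main.v *)
Require Import Defs.
From mathcomp Require Import all_boot.

Set Implicit Arguments.
Unset Strict Implicit.
Unset Printing Implicit Defensive.

(** In a connected graph the Fine sets are exactly the proper non-empty modules.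
    Two overlapping modules covering the graph force diameter at most 2, so for
    diameter at least 3 the union of two overlapping Fine sets is Fine and the
    maximal ones partition the vertices. For [x], [y] in distinct maximal Fine
    sets [A], [B], a common neighbour of the non-adjacent [x] and [y] lies in
    neither [A] nor [B], so [x], [y] are at distance 2 in G iff [A], [B] are at
    distance 2 in the quotient. Hence walks of [D2] project to the quotient,
    and walks of its [D2] lift to G through arbitrary representatives; two
    vertices of the same class are joined by passing through another class. *)

(** As [iota] is increasing, the head of the filtered list is its least element; this turns [dist]
    into a least path length. *)
Lemma ohead_filter_iota (P : pred nat) (m n d : nat) :
  ohead [seq k <- iota m n | P k] = Some d <->
  [/\ P d, m <= d < m + n & forall k, m <= k < d -> ~~ P k].
Proof.
elim: n m => [|n IHn] m /=.
  by split=> // -[_]; rewrite addn0 => /andP[md dm]; move: (leq_ltn_trans md dm); rewrite ltnn.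
case: ifP => Pm /=.
  split=> [[<-]|[Pd /andP[md _] min]].
    rewrite leqnn -addSnnS leq_addr; split=> // k /andP[mk km].
    by move: (leq_ltn_trans mk km); rewrite ltnn.
  case: (ltngtP m d) md => // [ltmd _|-> //].
  by have := min m; rewrite leqnn ltmd Pm => /(_ isT).
rewrite -addSnnS; apply: iff_trans (IHn m.+1) _; split=> -[Pd /andP[md dn] min]; split=> //.
- by rewrite ltnW.
- move=> k /andP[mk kd]; have [<-|nkm] := eqVneq m k; first by rewrite Pm.
  by apply: min; rewrite ltn_neqAle nkm mk.
- rewrite dn andbT ltn_neqAle md andbT.
  by apply: contraFneq Pm => ->.
- by move=> k /andP[mk kd]; apply: min; rewrite ltnW.
Qed.

(** * Distances at most 2 *)

Section Distance.
Context {T : finType} (e : rel T).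

Lemma distP (x y : T) (d : nat) :
  dist e x y = Some d <->
  [/\ has_path e d x y, d < #|T| & forall k, k < d -> ~~ has_path e k x y].
Proof. exact: ohead_filter_iota. Qed.

Lemma dist_le (k : nat) (x y : T) :
  has_path e k x y -> odflt 0 (dist e x y) <= k.
Proof.
(* For [None] the default 0 makes the bound trivial. *)
move=> pk; case E: (dist e x y) => [d|//] /=; rewrite leqNgt.
have /distP[_ _ min] := E.
by apply/negP=> /min; rewrite pk.
Qed.

Lemma has_path0 (x y : T) : has_path e 0 x y = (x == y).
Proof.
apply/existsP/eqP => [[p]|->]; first by rewrite tuple0 => /and3P[_ /eqP].
by exists [tuple]; rewrite /= eqxx.
Qed.

Hypothesis e_irr : irreflexive e.

Lemma has_path1 (x y : T) : has_path e 1 x y = e x y.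
Proof.
apply/existsP/idP => [[[[|a [|b p]] //= _]]|exy].
  by rewrite andbT => /and3P[exa /eqP<-].
exists [tuple y] => /=; rewrite exy eqxx !inE !andbT /=.
by apply: contraTneq exy => ->; rewrite e_irr.
Qed.

Lemma has_path2P (x y : T) :
  reflect (x != y /\ exists2 z, e x z & e z y) (has_path e 2 x y).
Proof.
apply: (iffP existsP) => [[[[|a [|b [|c p]]] //= _]]|[nxy [z exz ezy]]].
  rewrite andbT => /and3P[/andP[exa eab] /eqP<-].
  by rewrite !inE negb_or => /andP[/andP[_ ->]] _; split=> //; exists a.
exists [tuple z; y] => /=; rewrite exz ezy eqxx !inE !andbT negb_or nxy andbT /=.
apply/andP; split.
  by apply: contraTneq exz => ->; rewrite e_irr.
by apply: contraTneq ezy => ->; rewrite e_irr.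
Qed.

Lemma D2P (x y : T) :
  reflect [/\ x != y, ~~ e x y & exists2 z, e x z & e z y] (D2 e x y).
Proof.
apply: (iffP eqP) => [/distP[/has_path2P[nxy exz] _ min]|[nxy nexy exz]].
  by split=> //; have := min 1 isT; rewrite has_path1.
have p2 : has_path e 2 x y by apply/has_path2P.
apply/distP; split=> //; last by case=> [|[|]//]; rewrite ?has_path0 ?has_path1.
(* The path of length 2 has three distinct vertices, so 2 lies in the range below [#|T|] searched by
   [dist]. *)
have /existsP[p /and3P[_ _ up]] := p2.
by have := max_card [in x :: p]; rewrite (card_uniqP up) /= size_tuple.
Qed.

Lemma diam_le2 :
  (forall x y, [\/ x = y, e x y | exists2 z, e x z & e z y]) -> diam e <= 2.
Proof.
move=> close; apply/bigmax_leqP=> x _; apply/bigmax_leqP=> y _.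
have [<-|nxy] := eqVneq x y.
  by apply: leq_trans (dist_le (k := 0) _) _; rewrite ?has_path0.
case: (close x y) => [xy|exy|exz]; first by rewrite xy eqxx in nxy.
  by apply: leq_trans (dist_le (k := 1) _) _; rewrite ?has_path1.
by apply: dist_le; apply/has_path2P.
Qed.

End Distance.

(** * Fine sets as modules *)

Section Modules.
Context {T : finType} (e : rel T).

Definition module (A : {set T}) : Prop :=
  forall x y z, x \in A -> y \in A -> z \notin A -> e x z = e y z.

Lemma nbhdsP (A : {set T}) (z : T) :
  reflect (exists2 a, a \in A & e a z) (z \in nbhds e A).
Proof.
by apply: (iffP bigcupP) => -[a aA]; rewrite ?inE => eaz; exists a; rewrite ?inE.
Qed.

Lemma FineP (A : {set T}) :
  Fine e A <-> module A /\ exists a z, [/\ a \in A, z \notin A & e a z].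
Proof.
split=> [/and3P[_ /set0Pn[z]]|[modA [a [z [aA zA eaz]]]]].
  rewrite inE => /andP[zA /nbhdsP[a aA eaz]] /forall_inP homA.
  split; last by exists a, z.
  move=> x y t xA yA tA.
  have /setP/(_ t) : nbhd e x :\: A = nbhd e y :\: A.
    by rewrite (eqP (homA x xA)) (eqP (homA y yA)).
  by rewrite !inE tA.
apply/and3P; split; first by apply/set0Pn; exists a.
  by apply/set0Pn; exists z; rewrite inE zA; apply/nbhdsP; exists a.
apply/forall_inP=> x xA; apply/eqP/setP=> t; rewrite !inE.
case tA: (t \in A) => //=; apply/idP/nbhdsP => [ext|[b bA ebt]]; first by exists x.
by rewrite (modA x b) ?tA.
Qed.

Hypotheses (e_sym : symmetric e) (e_irr : irreflexive e).
Hypotheses (e_conn : connected e) (e_diam : 3 <= diam e).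

(** Otherwise [A] would be closed under adjacency, and connectedness would carry [a] to [b] inside
    [A]. *)
Lemma exit_edge (A : {set T}) (a b : T) :
  a \in A -> b \notin A -> exists x z, [/\ x \in A, z \notin A & e x z].
Proof.
move=> aA bA.
suff /existsP[x /existsP[z /and3P[xA zA exz]]] :
    [exists x, exists z, [&& x \in A, z \notin A & e x z]] by exists x, z.
apply: contraNT bA => /existsPn none.
rewrite -(closed_connect (e := e) _ (e_conn a b)) //.
apply: (intro_closed (sym_connect_sym e_sym)) => x y exy xA.
by have /existsPn/(_ y) := none x; rewrite xA exy andbT negbK.
Qed.

Lemma module_Fine (A : {set T}) (a b : T) :
  module A -> a \in A -> b \notin A -> Fine e A.
Proof. by move=> modA aA bA; apply/FineP; split=> //; apply: exit_edge aA bA. Qed.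

(** The shared vertex [c] is the reference: a vertex outside the union sees every member as it sees
    [c]. *)
Lemma moduleU (A B : {set T}) (c : T) :
  module A -> module B -> c \in A -> c \in B -> module (A :|: B).
Proof.
move=> modA modB cA cB.
suff toc x z : x \in A :|: B -> z \notin A :|: B -> e x z = e c z.
  by move=> x y z xAB yAB zAB; rewrite !toc.
rewrite !inE negb_or => /orP[xA|xB] /andP[zA zB]; first exact: modA.
exact: modB.
Qed.

(* If two Fine sets cover G, then A \ B, A :&: B and B \ A are pairwise
   completely joined. *)
Lemma Fine_cover_diam (A B : {set T}) :
  Fine e A -> Fine e B -> A :|: B = [set: T] -> diam e <= 2.
Proof.
move=> /FineP[modA [a [q [aA qA eaq]]]] /FineP[modB [b [p [bB pB _]]]] cover.
have inAB x : (x \in A) || (x \in B) by rewrite -in_setU cover inE.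
have pA : p \in A by have := inAB p; rewrite (negPf pB) orbF.
have qB : q \in B by have := inAB q; rewrite (negPf qA).
have eqA x : x \in A -> e x q by move=> xA; rewrite (modA x a).
(* Here [x] lies in [A], hence is adjacent to [q] in [B]; as [B] is a module, this edge spreads to
   all of [B]. *)
have joinB x y : x \notin B -> y \in B -> e x y.
  move=> xB yB; rewrite e_sym (modB y q) // e_sym eqA //.
  by have := inAB x; rewrite (negPf xB) orbF.
have joinA x y : x \notin A -> y \in A -> e x y.
  move=> xA yA; rewrite e_sym (modA y p) // joinB //.
  by have := inAB x; rewrite (negPf xA).
apply: diam_le2 => // x y.
case xA: (x \in A); last first.
  case yA: (y \in A); first by constructor 2; rewrite joinA ?xA.
  by constructor 3; exists p; [rewrite joinA ?xA | rewrite e_sym joinA ?yA].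
case yA: (y \in A); last by constructor 2; rewrite e_sym joinA ?yA.
by constructor 3; exists q; [apply: eqA | rewrite e_sym eqA].
Qed.

Lemma maxFine_eq (A B : {set T}) (c : T) :
  maxset (Fine e) A -> maxset (Fine e) B -> c \in A -> c \in B -> A = B.
Proof.
move=> /maxsetP[fA maxA] /maxsetP[fB maxB] cA cB.
suff fAB : Fine e (A :|: B).
  by rewrite -[LHS](maxA _ fAB) ?subsetUl // -[RHS](maxB _ fAB) ?subsetUr.
have [cover|] := eqVneq (A :|: B) setT.
  by have := Fine_cover_diam fA fB cover; rewrite leqNgt e_diam.
rewrite -subTset => /subsetPn[z _ zAB].
apply: (module_Fine (a := c) (b := z)) => //; last by rewrite inE cA.
by apply: moduleU cA cB; [case/FineP: fA | case/FineP: fB].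
Qed.

Lemma maxFine_cover (x : T) : exists A : hat_vertex e, x \in val A.
Proof.
have [y nxy] : exists y, y != x.
  (* A one-vertex graph has diameter at most 2, so a second vertex exists and the singleton of [x]
     is Fine. *)
  apply/existsP; apply: contraTT e_diam => /existsPn all_x.
  rewrite -leqNgt; apply: diam_le2 => // u v.
  by constructor 1; move: (all_x u) (all_x v); rewrite !negbK => /eqP-> /eqP->.
have fx : Fine e [set x].
  apply: (module_Fine (a := x) (b := y)); rewrite ?inE //.
  by move=> u v z /set1P-> /set1P->.
have [A maxA /subsetP sxA] := maxset_exists fx.
by exists (exist _ A maxA); apply: sxA; rewrite inE.
Qed.

(** * The quotient by maximal Fine sets *)

Lemma hat_vertex_eq (A B : hat_vertex e) (c : T) :
  c \in val A -> c \in val B -> A = B.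
Proof. by move=> cA cB; apply/val_inj/(maxFine_eq (c := c)) => //; exact: valP. Qed.

Lemma hat_vertex_module (A : hat_vertex e) : module (val A).
Proof. by have /maxsetp/FineP[] := valP A. Qed.

Lemma hat_vertex_mem (A : hat_vertex e) : exists x, x \in val A.
Proof. by have /maxsetp/FineP[_ [x [z [xA _ _]]]] := valP A; exists x. Qed.

Lemma hat_vertex_other (A : hat_vertex e) : exists B : hat_vertex e, A != B.
Proof.
have /maxsetp/FineP[_ [x [z [_ zA _]]]] := valP A.
have [B zB] := maxFine_cover z; exists B.
by apply: contraNneq zA => ->.
Qed.

(** Classes are disjoint modules, so an edge between any representatives moves to [x] and [y] one
    end at a time. *)
Lemma hat_adj_rep (A B : hat_vertex e) (x y : T) :
  A != B -> x \in val A -> y \in val B -> hat_adj A B = e x y.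
Proof.
move=> nAB xA yB; rewrite /hat_adj nAB /=.
have notA t : t \in val B -> t \notin val A.
  by move=> tB; apply: contraNN nAB => tA; rewrite (hat_vertex_eq tA tB).
apply/exists_inP/idP => [[u uA /exists_inP[v vB euv]]|exy]; last first.
  by exists x => //; apply/exists_inP; exists y.
rewrite (hat_vertex_module (x := x) (y := u) xA) ?notA // e_sym.
rewrite (hat_vertex_module (x := y) (y := v) yB) //; first by rewrite e_sym.
by apply/negP=> /notA; rewrite uA.
Qed.

Lemma hat_adj_irr : irreflexive (@hat_adj T e).
Proof. by move=> A; rewrite /hat_adj eqxx. Qed.

Lemma D2_hat_rep (A B : hat_vertex e) (x y : T) :
  A != B -> x \in val A -> y \in val B -> D2 (@hat_adj T e) A B = D2 e x y.
Proof.
move=> nAB xA yB.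
apply/(D2P hat_adj_irr)/(D2P e_irr) => -[nxy nexy [c]]; rewrite (hat_adj_rep nAB xA yB) in nexy *.
  move=> AC CB; have [z zC] := hat_vertex_mem c.
  have nAC : A != c by case/andP: AC.
  have nCB : c != B by case/andP: CB.
  rewrite (hat_adj_rep nAC xA zC) in AC; rewrite (hat_adj_rep nCB zC yB) in CB.
  split=> //; last by exists z.
  by apply: contraNneq nAB => xy; rewrite xy in xA; rewrite (hat_vertex_eq xA yB).
move=> exc ecy; have [C cC] := maxFine_cover c.
split=> //; exists C.
  (* If [c] lay in [A], the edge from [c] to [y] would force one from [x] to [y]; the case of [B] is
     symmetric. *)
  rewrite (hat_adj_rep _ xA cC) //; apply: contraNneq nexy => AC.
  rewrite -AC in cC; by rewrite -(hat_adj_rep nAB xA yB) (hat_adj_rep nAB cC yB).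
rewrite (hat_adj_rep _ cC yB) //; apply: contraNneq nexy => CB.
rewrite CB in cC; by rewrite -(hat_adj_rep nAB xA yB) (hat_adj_rep nAB xA cC).
Qed.

(** * Transfer of walks *)

Lemma connect_D2_project (x y : T) (A B : hat_vertex e) :
  connect (D2 e) x y -> x \in val A -> y \in val B ->
  connect (D2 (@hat_adj T e)) A B.
Proof.
case/connectP=> p + ->; elim: p x A => [|z p IHp] x A /=.
  by move=> _ xA xB; rewrite (hat_vertex_eq xA xB) connect0.
case/andP=> xz zp xA lB; have [C zC] := maxFine_cover z.
apply: connect_trans (IHp z C zp zC lB).
(* Vertices at distance 2 may share a class; such a step collapses. *)
have [->|nAC] := eqVneq A C; first exact: connect0.
by apply: connect1; rewrite (D2_hat_rep nAC xA zC).
Qed.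

(** The classes are kept distinct because the empty walk on one class would not join two of its
    members. *)
Lemma connect_D2_lift (A B : hat_vertex e) (x y : T) :
  connect (D2 (@hat_adj T e)) A B -> A != B -> x \in val A -> y \in val B ->
  connect (D2 e) x y.
Proof.
case/connectP=> p; elim: p A x => [|C p IHp] A x /=.
  by move=> _ ->; rewrite eqxx.
case/andP=> AC Cp lB nAB xA yB.
have nAC : A != C by case/(D2P hat_adj_irr): AC.
(* Once the walk reaches [B], it is sent straight to [y] and its remainder is dropped. *)
have [CB|nCB] := eqVneq C B.
  by rewrite -CB in yB; apply: connect1; rewrite -(D2_hat_rep nAC xA yB).
have [z zC] := hat_vertex_mem C.
apply: connect_trans (IHp C z Cp lB nCB zC yB).
by apply: connect1; rewrite -(D2_hat_rep nAC xA zC).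
Qed.

End Modules.

Theorem theorem2p16 (T : finType) (e : rel T) (e_sym : symmetric e)
  (e_irr : irreflexive e) (e_conn : connected e) (e_diam : 3 <= diam e) :
  connected (D2 e) <-> connected (D2 (@hat_adj T e)).
Proof.
split=> conn.
  move=> A B; have [x xA] := hat_vertex_mem A; have [y yB] := hat_vertex_mem B.
  by apply: connect_D2_project (conn x y) xA yB.
have lift (A B : hat_vertex e) x y :
    A != B -> x \in val A -> y \in val B -> connect (D2 e) x y.
  by move=> nAB; apply: connect_D2_lift.
move=> x y.
have [A xA] : exists A : hat_vertex e, x \in val A by apply: maxFine_cover.
have [B yB] : exists B : hat_vertex e, y \in val B by apply: maxFine_cover.
have [AB|nAB] := eqVneq A B; last exact: lift nAB xA yB.
(* Both vertices lie in [B]: detour through a vertex [z] of another class. *)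
have [C nBC] : exists C : hat_vertex e, B != C by apply: hat_vertex_other.
have [z zC] := hat_vertex_mem C; rewrite AB in xA.
apply: connect_trans (lift B C x z nBC xA zC) _.
by apply: lift zC yB; rewrite eq_sym.
Qed.
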